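(* Let $(U,V_1)$ be random variables with joint distribution $p(u,v_1)$, let $p(v)$ denote the marginal of $V_1$, and let $k\ge 2$. Fix a measurable function $f$ with real values defined on pairs $(u,v)$, and for each $u$ put $c(u)=\mathbf{E}_{v\sim p(v)}[e^{f(u,v)}]$, assumed finite. For each $u$ choose a Borel set $B_u\subset\mathbf{R}$ strictly lower-bounded by $c(u)$, i.e. $b>c(u)$ for every $b\in B_u$, and set $S_{B_u}=\{v : e^{f(u,v)}\in B_u\}$, assumed to satisfy $p(S_{B_u})>0$. Define the conditional distribution $q(\cdot\mid u)$ of $V_{2:k}=(V_2,\dots,V_k)$ on Borel rectangles $A=A_2\times\cdots\times A_k$ by $$q(V_{2:k}\in A\mid u)=\prod_{j=2}^k p(A_j\mid S_{B_u}),\qquad p(A_j\mid S_{B_u})=\frac{p(A_j\cap S_{B_u})}{p(S_{B_u})},$$ (so $V_2,\dots,V_k$ are i.i.d. from the marginal $p(v)$ conditioned on $S_{B_u}$). Define $$\mathcal{L}_{\mathrm{CNCE}}(U;V_1)=\mathbf{E}_{(u,v_1)\sim p(u,v_1)}\,\mathbf{E}_{v_{2:k}\sim q(\cdot\mid u)}\left[\log\frac{e^{f(u,v_1)}}{\frac1k\sum_{j=1}^k e^{f(u,v_j)}}\right]$$ and $$\mathcal{L}_{\mathrm{NCE}}(U;V_1)=\mathbf{E}_{(u,v_1)\sim p(u,v_1)}\,\mathbf{E}_{v_2,\dots,v_k\overset{\text{i.i.d.}}{\sim} p(v)}\left[\log\frac{e^{f(u,v_1)}}{\frac1k\sum_{j=1}^k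 e^{f(u,v_j)}}\right],$$ assuming all expectations are well defined. Then $$\mathcal{L}_{\mathrm{CNCE}}(U;V_1)\le \mathcal{L}_{\mathrm{NCE}}(U;V_1)\le \mathcal{I}(U;V_1),$$ where $\mathcal{I}(U;V_1)$ is the mutual information between $U$ and $V_1$.
   Context: $\mathcal{L}_{\mathrm{NCE}}$ is the noise-contrastive estimation (InfoNCE) objective, in which the ''negative examples'' $v_2,\dots,v_k$ are drawn i.i.d. from the marginal of $V_1$, independently of $(u,v_1)$; $\mathcal{L}_{\mathrm{CNCE}}$ (conditional NCE) is the same objective with negatives drawn from the restricted, renormalized marginal $q$. *)

(* Defs.v *)
From HB Require Import structures.
From mathcomp Require Import all_boot all_order all_algebra.
From mathcomp Require Import all_classical all_reals all_analysis.
Set Implicit Arguments.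
Unset Strict Implicit.
Unset Printing Implicit Defensive.
Import Order.TTheory GRing.Theory Num.Theory.
Import numFieldNormedType.Exports.
Local Open Scope classical_set_scope.
Local Open Scope ring_scope.

Section projections.
Context d1 d2 (U : measurableType d1) (V : measurableType d2).

Lemma fst_in_mfun : (@fst U V) \in mfun.
Proof. by rewrite inE; exact: measurable_fst. Qed.

Lemma snd_in_mfun : (@snd U V) \in mfun.
Proof. by rewrite inE; exact: measurable_snd. Qed.

Definition fst_mfun : {mfun (U * V)%type >-> U} := mfun_Sub fst_in_mfun.
Definition snd_mfun : {mfun (U * V)%type >-> V} := mfun_Sub snd_in_mfun.
End projections.

Section information.
Context d1 d2 (U : measurableType d1) (V : measurableType d2) (R : realType).
Variable P : probability (U * V)%type R.

Definition marginal1 : probability U R := distribution P (fst_mfun U V).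
Definition marginal2 : probability V R := distribution P (snd_mfun U V).

Definition marginal_product : probability (U * V)%type R :=
  (marginal1 \x marginal2)%E.

(* Kullback-Leibler divergence KL(p(u,v) || p(u) p(v)), i.e. the mutual
   information I(U;V):  \int log (dP/dQ) dP  if P << Q, and +oo otherwise,
   where dP/dQ is the Radon-Nikodym derivative. *)
Definition mutual_information : \bar R :=
  if pselect ((charge_of_finite_measure P) `<< marginal_product)
  then (\int[P]_x lne (Radon_Nikodym (charge_of_finite_measure P)
                         marginal_product x))%E
  else +oo%E.
End information.

Definition rect (T : Type) (n : nat) (A : 'I_n -> set T) : set (n.-tuple T) :=
  [set w | forall j : 'I_n, A j (tnth w j)].

Definition condp d (T : measurableType d) (R : realType)
  (mu : set T -> \bar R) (S A : set T) : R :=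
  fine (mu (A `&` S)) / fine (mu S).

(* the integrand  log ( e^{f(u,v_1)} / ((1/k) sum_{j=1}^k e^{f(u,v_j)}) ),
   where x = (u, v_1) and w = (v_2, ..., v_k) *)
Definition nce_integrand (U V : Type) (R : realType) (k : nat)
  (f : U * V -> R) (x : U * V) (w : (k.-1).-tuple V) : R :=
  ln (expR (f x) /
      ((k%:R)^-1 * (expR (f x) + \sum_(j < k.-1) expR (f (x.1, tnth w j))))).

(* Main.v *)
Require Import Defs.
From HB Require Import structures.
From mathcomp Require Import all_boot all_order all_algebra.
From mathcomp Require Import perm.
From mathcomp Require Import all_classical all_reals all_analysis measurable_realfun.
From mathcomp Require Import lra.
Import Order.TTheory GRing.Theory Num.Theory.
Import numFieldNormedType.Exports.
Local Open Scope classical_set_scope.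
Local Open Scope ring_scope.
Set Implicit Arguments.
Unset Strict Implicit.

(** For fixed [x = (u, v_1)] put [a = e^{f(x)}] and [c = c(u)]; both inner
    expectations are compared with [m = log (a / ((a + (k-1) c) / k))].  Under
    [q] every negative satisfies [e^{f(u,v_j)} > c], so the integrand is at
    most [m] almost surely; under i.i.d. sampling Jensen's inequality bounds
    the expectation below by [m].

    For the upper bound, let [h(x)] be the expectation of the integrand over
    the i.i.d. negatives.  By Jensen [e^h] is at most the expectation of
    [a / (1/k) sum_j e^{f(u,v_j)}].  When [v_1] is itself drawn from [p(v)],
    independently of [u], the [k] shares [e^{f(u,v_i)} / sum_j e^{f(u,v_j)}]
    are exchangeable and sum to [1], so [e^h] has integral at most [1] under
    the product of the marginals, and the Donsker-Varadhan inequality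
    concludes. *)

(** * Integral comparison, Jensen's inequality and the Donsker-Varadhan inequality *)

(* Compare positive and negative parts separately; [leeB] is valid for infinite
   values, so [g] may have integral [+oo]. *)
Lemma ae_le_integral d (T : measurableType d) (R : realType)
    (mu : {measure set T -> \bar R}) (f g : T -> \bar R) :
  measurable_fun setT f -> measurable_fun setT g ->
  {ae mu, forall x, (f x <= g x)%E} ->
  (\int[mu]_x f x <= \int[mu]_x g x)%E.
Proof.
move=> mf mg fg; rewrite integralE [leRHS]integralE leeB//.
- apply: ae_ge0_le_integral => //; [exact: measurable_funepos..|].
  apply: filterS fg => x fgx _.
  by rewrite !funeposE ge_max !le_max fgx lexx orbT.
- apply: ae_ge0_le_integral => //; [exact: measurable_funeneg..|].
  apply: filterS fg => x fgx _.
  by rewrite !funenegE ge_max !le_max leeN2 fgx lexx orbT.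
Qed.

Lemma measurable_lne (R : realType) : measurable_fun setT (@lne R).
Proof.
have -> : @lne R = fun x : \bar R => if (x <= 0)%E then -oo%E else
    if (+oo <= x)%E then +oo%E else (ln (fine x))%:E.
  by apply/funext => -[r| |] //=; rewrite leNye.
apply: measurable_fun_ifT; [exact: measurable_fun_lee|by []|].
apply: measurable_fun_ifT; [exact: measurable_fun_lee|by []|].
by apply/measurable_EFinP; exact: measurableT_comp.
Qed.

(** Jensen for the exponential: the tangent line at the mean [m] gives [e^m (1 + g - m) <= e^g], and
    its left side integrates to [e^m]. The integral of [e^g] may be [+oo]. *)
Lemma expR_Rintegral_le d (T : measurableType d) (R : realType)
    (P : probability T R) (g : T -> R) :
  P.-integrable setT (EFin \o g) ->
  ((expR (fine (\int[P]_x (g x)%:E)))%:E <= \int[P]_x (expR (g x))%:E)%E.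
Proof.
move=> ig; set m := fine _.
have mg : measurable_fun setT g by apply/measurable_EFinP; exact: measurable_int ig.
have ic (c : R) : P.-integrable setT (EFin \o cst c).
  exact: finite_measure_integrable_cst.
have mE : (\int[P]_x (g x)%:E)%E = m%:E.
  by rewrite fineK//; exact: integrable_fin_num.
have <- : (\int[P]_x ((expR m)%:E * ((g x)%:E + (1 - m)%:E)) = (expR m)%:E)%E.
  rewrite integralZl//; last by apply: integrableD => //; exact: ic.
  rewrite integralD//; last exact: ic.
  rewrite mE integral_cst//= probability_setT mule1 -EFinD addrC subrK.
  by rewrite mule1.
apply: ae_le_integral.
- apply: measurable_funeM; apply: emeasurable_funD => //.
  by apply/measurable_EFinP.
- apply/measurable_EFinP; exact: measurableT_comp.
apply: aeW => x; rewrite -EFinD -EFinM lee_fin.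
rewrite -[in leRHS](subrK m (g x)) expRD mulrC ler_wpM2r ?expR_ge0//.
by rewrite addrCA expR_ge1Dx.
Qed.

(** The variational formula when its log-partition term is nonpositive. With [r = dP/dQ], the
    [P]-integral of [e^h / r] is at most the [Q]-integral of [e^h], hence at most 1; a pointwise
    lower bound on [ln r] is then integrated. *)
Lemma donsker_varadhan d (T : measurableType d) (R : realType)
    (P Q : probability T R) (h : T -> R) :
  (charge_of_finite_measure P) `<< Q ->
  P.-integrable setT (EFin \o h) ->
  (\int[Q]_x (expR (h x))%:E <= 1)%E ->
  (\int[P]_x (h x)%:E <=
   \int[P]_x lne (Radon_Nikodym (charge_of_finite_measure P) Q x))%E.
Proof.
move=> PQ ih Qh.
have PQ' : P `<< Q by [].
(* This version of the density is finite and nonnegative everywhere; [rd] identifies it [P]-almost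
   everywhere with the one in the statement. *)
pose r := Radon_Nikodym_SigmaFinite.f P Q.
have r0 x : (0 <= r x)%E by exact: Radon_Nikodym_SigmaFinite.f_ge0.
have rfin x : r x \is a fin_num by exact: Radon_Nikodym_SigmaFinite.f_fin_num.
have mr : measurable_fun setT r.
  by apply: measurable_int; exact: (Radon_Nikodym_SigmaFinite.f_integrable PQ').
have mh : measurable_fun setT h by apply/measurable_EFinP; exact: measurable_int ih.
have rd : {ae P, forall x,
    r x = Radon_Nikodym (charge_of_finite_measure P) Q x}.
  have /(null_dominates_ae_eq measurableT PQ') :=
    ae_eq_Radon_Nikodym_SigmaFinite PQ' measurableT.
  by apply: filterS => x /(_ I).
(* The set where [r = 0] has [P]-measure equal to the [Q]-integral of [r] over it, which
   vanishes. *)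
have r_gt0 : {ae P, forall x, (0 < r x)%E}.
  exists [set x | r x = 0%E]; split.
  - rewrite -[X in measurable X]setTI; exact: measurable_eqe.
  - rewrite (Radon_Nikodym_SigmaFinite.f_integral PQ')//; last first.
      rewrite -[X in measurable X]setTI; exact: measurable_eqe.
    by apply: integral0_eq => x.
  - move=> x /=; apply: contra_notP => /eqP rx0.
    by rewrite lt_neqAle eq_sym rx0 r0.
(* [e = e^h / r]; the pointwise bound [h - e + 1 <= ln r] is [1 + t <= e^t] at
   [t = h - ln r]. *)
pose e x := expR (h x - ln (fine (r x))).
have me : measurable_fun setT (EFin \o e).
  apply/measurable_EFinP; apply: measurableT_comp => //.
  apply: measurable_funB => //; apply: measurableT_comp => //.
  exact: measurableT_comp.
(* Against [Q] the integrand becomes [e r], which is [e^h] where [r > 0] but 0 where [r = 0]; hence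
   only an inequality. *)
have e1 : (\int[P]_x (e x)%:E <= 1)%E.
  rewrite -(Radon_Nikodym_SigmaFinite.change_of_variables PQ')//; last first.
    by move=> x; rewrite lee_fin expR_ge0.
  apply: le_trans Qh; apply: ge0_le_integral => //.
  - by move=> x _; rewrite mule_ge0// lee_fin expR_ge0.
  - exact: emeasurable_funM.
  - by apply/measurable_EFinP; exact: measurableT_comp.
  move=> x _; rewrite -/r -(fineK (rfin x)) -EFinM lee_fin /e.
  have := r0 x; rewrite -(fineK (rfin x)) lee_fin/= le_eqVlt => /predU1P[<-|rx].
    by rewrite mulr0 expR_ge0.
  by rewrite expRD expRN lnK// mulfVK// gt_eqF.
have ie : P.-integrable setT (EFin \o e).
  apply/integrableP; split => //; rewrite (le_lt_trans _ (ltry 1))//.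
  apply: le_trans e1; apply: ge0_le_integral => //; first exact: measurableT_comp.
  by move=> x _ /=; rewrite ger0_norm ?expR_ge0.
have i1 : P.-integrable setT (EFin \o cst (1 : R)).
  exact: finite_measure_integrable_cst.
(* By [e1], adding [1 - e] does not lower the integral. *)
apply: (@le_trans _ _ (\int[P]_x ((h x)%:E - (e x)%:E + 1%:E))%E).
  rewrite integralD//; last exact: integrableB.
  rewrite integralB_EFin// integral_cst//= probability_setT mul1e.
  rewrite -addeA leeDl// addeC sube_ge0//.
  by rewrite integrable_fin_num.
apply: ae_le_integral.
- apply: emeasurable_funD => //; apply: emeasurable_funB => //.
  by apply/measurable_EFinP.
- apply: measurableT_comp; first exact: measurable_lne.
  by apply: measurable_int; exact: Radon_Nikodym_integrable.
apply: filterS2 rd r_gt0 => x <- rx.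
rewrite -(fineK (rfin x)) lne_EFin ?fine_gt0 ?rx ?ltey_eq ?rfin//.
rewrite -EFinB -EFinD lee_fin /e.
by have := expR_ge1Dx (h x - ln (fine (r x))); lra.
Qed.

(** * I.i.d. tuples: uniqueness, coordinate laws, exchangeability *)

Lemma measurable_rect d (T : measurableType d) n (A : 'I_n -> set T) :
  (forall j, measurable (A j)) -> measurable (rect A).
Proof.
move=> mA; have -> : rect A = \bigcap_(j in [set: 'I_n]) [set t | A j (tnth t j)].
  by apply/seteqP; split => [t At j _|t At j]; [exact: At|exact: (At j I)].
apply: fin_bigcap_measurable => // j _.
rewrite -[X in measurable X]setTI.
exact: (measurable_tnth j measurableT (mA j)).
Qed.

(** Measurable rectangles are stable under intersection and generate the sigma-algebra of tuples,
    since the preimage of [B] under coordinate [i] is the rectangle with [B] in slot [i] and the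
    whole space elsewhere. *)
Lemma tuple_measure_unique d (T : measurableType d) n (R : realType)
    (m1 m2 : probability (n.-tuple T) R) :
  (forall A : 'I_n -> set T, (forall j, measurable (A j)) ->
    m1 (rect A) = m2 (rect A)) ->
  forall X, measurable X -> m1 X = m2 X.
Proof.
move=> m12; pose G :=
  [set rect A | A in [set A : 'I_n -> set T | forall j, measurable (A j)]].
have rectT : rect (fun _ : 'I_n => [set: T]) = setT by apply/seteqP; split.
apply: (measure_unique G (fun=> setT)).
- apply/seteqP; split.
    apply: smallest_sub; first exact: smallest_sigma_algebra.
    rewrite -bigcup_seq/= => _ [i _ [B mB <-]].
    apply: sub_sigma_algebra; exists (fun j => if j == i then B else setT).
      by move=> j /=; case: ifP.
    rewrite setTI; apply/seteqP; split => [t /(_ i)|t Bt j]; first by rewrite eqxx.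
    by case: eqP => // ->.
  apply: smallest_sub; first exact: sigma_algebra_measurable.
  by move=> _ [A mA <-]; exact: measurable_rect.
- move=> _ _ [A mA <-] [B mB <-]; exists (fun j => A j `&` B j).
    by move=> j; exact: measurableI.
  by apply/seteqP; split => [t ABt|t [At Bt] j]; [split=> j; case: (ABt j)|split].
- by move=> _; exists (fun=> setT).
- exact: bigcup_const.
- by move=> _ [A mA <-]; exact: m12.
- by move=> _ /=; rewrite probability_setT ltry.
Qed.

(** Stated on rectangles only, which determines [M] by [tuple_measure_unique]. *)
Definition iid d (T : measurableType d) n (R : realType)
    (p : probability T R) (M : probability (n.-tuple T) R) :=
  forall A : 'I_n -> set T, (forall j, measurable (A j)) ->
    M (rect A) = (\prod_(j < n) fine (p (A j)))%:E.

Lemma ge0_integral_iid_tnth d (T : measurableType d) n (R : realType)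
    (p : probability T R) (M : probability (n.-tuple T) R) (i : 'I_n)
    (g : T -> \bar R) :
  iid p M -> measurable_fun setT g -> (forall v, 0 <= g v)%E ->
  (\int[M]_t g (tnth t i) = \int[p]_v g v)%E.
Proof.
move=> Mp mg g0.
have mi : (fun t : n.-tuple T => tnth t i) \in mfun.
  by rewrite inE; exact: measurable_tnth.
have := ge0_integral_distribution (P := M) (mfun_Sub mi) mg g0.
rewrite /comp /= => <-; apply: eq_measure_integral => A mA _.
rewrite -[LHS]/(M ((fun t : n.-tuple T => tnth t i) @^-1` A)).
have -> : (fun t : n.-tuple T => tnth t i) @^-1` A =
    rect (fun j => if j == i then A else setT).
  apply/seteqP; split => [t At j|t /(_ i)]; last by rewrite eqxx.
  by case: eqP => // ->.
rewrite Mp; last by move=> j; case: ifP.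
rewrite (bigD1 i)//= eqxx big1 ?mulr1; first by rewrite fineK// fin_num_measure.
by move=> j /negbTE ->; rewrite probability_setT.
Qed.

(** The image of [M] under a permutation of coordinates agrees with [M] on rectangles, where the
    factors of the product are merely reordered. *)
Lemma iid_perm d (T : measurableType d) n (R : realType)
    (p : probability T R) (M : probability (n.-tuple T) R) (s : 'S_n)
    (g : n.-tuple T -> \bar R) :
  iid p M -> measurable_fun setT g -> (forall t, 0 <= g t)%E ->
  (\int[M]_t g [tuple tnth t (s j) | j < n] = \int[M]_t g t)%E.
Proof.
move=> Mp mg g0; pose S (t : n.-tuple T) := [tuple tnth t (s j) | j < n].
have mS : S \in mfun.
  rewrite inE /=; apply/measurable_fun_tnthP => i.
  rewrite (_ : _ \o _ = (fun t => tnth t (s i))); first exact: measurable_tnth.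
  by apply/funext => t; rewrite /= tnth_mktuple.
have := ge0_integral_distribution (P := M) (mfun_Sub mS) mg g0.
rewrite /comp /= => <-; apply: eq_measure_integral => X mX _.
apply: tuple_measure_unique mX => A mA.
rewrite -[LHS]/(M (S @^-1` rect A)).
have -> : S @^-1` rect A = rect (A \o (s^-1)%g).
  apply/seteqP; split => t At j.
    by have /= := At ((s^-1)%g j); rewrite tnth_mktuple permKV.
  by have /= := At (s j); rewrite tnth_mktuple permK.
rewrite !Mp//; last by move=> j /=; exact: mA.
congr EFin.
by rewrite [RHS](reindex_inj (@perm_inj _ (s^-1)%g)).
Qed.

(** Puts an independent [v_1] on the same footing as the negatives: [M'] is the image of the product
    of [p] and [M] under cons, and Tonelli gives the iterated integral. *)
Lemma iid_cons d (T : measurableType d) n (R : realType)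
    (p : probability T R) (M : probability (n.-tuple T) R) :
  iid p M -> exists M' : probability (n.+1.-tuple T) R, iid p M' /\
    forall g, measurable_fun setT g -> (forall t, 0 <= g t)%E ->
    (\int[M']_t g t = \int[p]_v \int[M]_w g [tuple of v :: w])%E.
Proof.
move=> Mp.
have mC : (fun x : T * n.-tuple T => [tuple of x.1 :: x.2]) \in mfun.
  by rewrite inE /=; exact: measurable_cons.
exists (distribution (p \x M)%E (mfun_Sub mC)); split => [A mA|g mg g0].
  rewrite -[LHS]/((p \x M)%E
    ((fun x : T * n.-tuple T => [tuple of x.1 :: x.2]) @^-1` rect A)).
  have -> : (fun x : T * n.-tuple T => [tuple of x.1 :: x.2]) @^-1` rect A =
      A ord0 `*` rect (fun j : 'I_n => A (lift ord0 j)).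
    apply/seteqP; split => [[v w] At|[v w] [/= Av Aw] j].
      by split => [|j]; [exact: (At ord0)|have := At (lift ord0 j); rewrite tnthS].
    by case: (unliftP ord0 j) => [i ->|->]; [rewrite tnthS; exact: Aw|].
  rewrite product_measure1E//; last exact: measurable_rect.
  transitivity (p (A ord0) * (\prod_(j < n) fine (p (A (lift ord0 j))))%:E)%E.
    by congr (_ * _)%E; exact: Mp.
  by rewrite big_ord_recl EFinM fineK// fin_num_measure.
rewrite ge0_integral_distribution// fubini_tonelli1//=.
by apply: (measurableT_comp mg); exact: measurable_cons.
Qed.

(** By exchangeability the [n.+1] normalized shares have equal integrals; they sum pointwise to
    [n.+1], so each integrates to 1. *)
Lemma iid_share d (T : measurableType d) n (R : realType)
    (p : probability T R) (M : probability (n.-tuple T) R) (F : T -> R) :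
  iid p M -> measurable_fun setT F ->
  (\int[p]_v \int[M]_w (expR (F v) /
    (n.+1%:R^-1 * (expR (F v) + \sum_(j < n) expR (F (tnth w j)))))%:E = 1)%E.
Proof.
move=> Mp mF; have [M' [M'p M'E]] := iid_cons Mp.
pose Z (t : n.+1.-tuple T) := n.+1%:R^-1 * \sum_(j < n.+1) expR (F (tnth t j)).
have Z_gt0 t : 0 < Z t.
  rewrite mulr_gt0 ?invr_gt0// big_ord_recl ltr_pwDl ?expR_gt0//.
  by rewrite sumr_ge0// => j _; exact: expR_ge0.
pose g i t := (expR (F (tnth t i)) / Z t)%:E.
have g0 i t : (0 <= g i t)%E by rewrite lee_fin divr_ge0 ?expR_ge0// ltW.
have mFt (i : 'I_n.+1) : measurable_fun setT (fun t : n.+1.-tuple T => F (tnth t i)).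
  by apply: measurableT_comp => //; exact: measurable_tnth.
have mg i : measurable_fun setT (g i).
  apply/measurable_EFinP.
  (* Writing the quotient as an exponential reduces its measurability to that of [expR] and [ln]. *)
  rewrite (_ : (fun _ => _) = fun t => expR (F (tnth t i) - ln (Z t))); last first.
    by apply/funext => t; rewrite expRD expRN lnK// posrE.
  apply: measurableT_comp => //; apply: measurable_funB => //.
  apply: measurableT_comp => //; apply: measurable_funM => //.
  by apply: measurable_sum => j; exact: measurableT_comp.
transitivity (\int[M']_t g ord0 t)%E.
  rewrite M'E//; apply: eq_integral => v _; apply: eq_integral => w _.
  by rewrite /g /Z big_ord_recl tnth0; under [in RHS]eq_bigr do rewrite tnthS.
have gE i : (\int[M']_t g i t = \int[M']_t g ord0 t)%E.
  rewrite -(iid_perm (tperm ord0 i) M'p (mg ord0))//.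
  apply: eq_integral => t _; rewrite /g tnth_mktuple tpermL; congr (_ / (_ * _))%:E.
  rewrite (reindex_inj (@perm_inj _ (tperm ord0 i))).
  by apply: eq_bigr => j _; rewrite tnth_mktuple.
have : (\sum_(i < n.+1) \int[M']_t g i t = n.+1%:R%:E)%E.
  rewrite -ge0_integral_sum//.
  transitivity (\int[M']_t (cst n.+1%:R%:E t))%E.
    apply: eq_integral => t _; rewrite /g sumEFin -mulr_suml invfM invrK mulrCA.
    rewrite divff ?mulr1//; have := Z_gt0 t.
    by rewrite pmulr_rgt0 ?invr_gt0// => /gt_eqF ->.
  by rewrite integral_cst//= probability_setT mule1.
under eq_bigr do rewrite gE.
(* The common integral is not yet known to be finite; an infinite value would contradict the finite
   sum. *)
case: (\int[M']_t _)%E => [r| |].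
- rewrite sumEFin sumr_const card_ord => -[] rn; congr EFin.
  by apply: (@mulIf _ n.+1%:R); rewrite ?pnatr_eq0// mul1r mulr_natr.
- by rewrite big_ord_recl addye// gt_eqF// (lt_le_trans ltNy0)// sume_ge0.
- by rewrite big_ord_recl addNye.
Qed.

(** * Bounds on the inner expectation for fixed [x] *)

(** Jensen is applied to minus the integrand: its exponential is affine in the terms [e^{f(u,v_j)}],
    so its expectation is computed exactly by linearity. *)
Lemma integral_nce_iid_ge d1 d2 (U : measurableType d1) (V : measurableType d2)
    (R : realType) n (p : probability V R) (M : probability (n.-tuple V) R)
    (f : U * V -> R) (x : U * V) (c : R) :
  iid p M -> measurable_fun setT f ->
  (\int[p]_v (expR (f (x.1, v)))%:E = c%:E)%E ->
  M.-integrable setT (fun w => (nce_integrand (k := n.+1) f x w)%:E) ->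
  ((ln (expR (f x) / (n.+1%:R^-1 * (expR (f x) + c *+ n))))%:E <=
   \int[M]_w (nce_integrand (k := n.+1) f x w)%:E)%E.
Proof.
move=> Mp mf cE inc; set a := expR (f x); set I := (\int[M]_w _)%E.
pose b w := \sum_(j < n) expR (f (x.1, tnth w j)).
have a0 : 0 < a by exact: expR_gt0.
have b0 w : 0 <= b w by apply: sumr_ge0 => j _; exact: expR_ge0.
have c0 : 0 <= c.
  by rewrite -lee_fin -cE; apply: integral_ge0 => v _; rewrite lee_fin expR_ge0.
have mfx : measurable_fun setT (fun v => expR (f (x.1, v))).
  by do 2 apply: measurableT_comp => //; exact: pair1_measurable.
have mft j : measurable_fun setT (fun w : n.-tuple V => expR (f (x.1, tnth w j))).
  by apply: (measurableT_comp mfx); exact: measurable_tnth.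
have iE : (\int[M]_w (expR (- nce_integrand (k := n.+1) f x w))%:E =
    (n.+1%:R^-1 * (a + c *+ n) / a)%:E)%E.
  transitivity (\int[M]_w ((n.+1%:R^-1 / a)%:E *
      (a%:E + \sum_(j < n) (expR (f (x.1, tnth w j)))%:E)))%E.
    apply: eq_integral => w _; rewrite sumEFin -EFinD -EFinM; congr EFin.
    have ab0 : 0 < n.+1%:R^-1 * (a + b w) by rewrite mulr_gt0 ?invr_gt0// ltr_pwDl.
    rewrite /nce_integrand -/a -/(b w) -lnV ?posrE ?divr_gt0//.
    rewrite lnK ?posrE ?invr_gt0 ?divr_gt0//.
    by rewrite invf_div mulrAC.
  rewrite ge0_integralZl//.
  - rewrite ge0_integralD//; last first.
    + by apply: emeasurable_sum => j; exact/measurable_EFinP.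
    + by move=> w _; rewrite sumEFin lee_fin; exact: b0.
    + by move=> w _; rewrite lee_fin ltW.
    rewrite integral_cst//= probability_setT mule1 ge0_integral_sum//; last first.
    + by move=> j; exact/measurable_EFinP.
    rewrite (eq_bigr (fun=> c%:E)); last first.
      move=> j _; rewrite -cE.
      apply: (ge0_integral_iid_tnth j Mp (g := fun v => (expR (f (x.1, v)))%:E)).
        exact/measurable_EFinP.
      by move=> v; rewrite lee_fin expR_ge0.
    by rewrite sumEFin sumr_const card_ord -EFinD -EFinM mulrAC.
  - apply: emeasurable_funD => //.
    by apply: emeasurable_sum => j; exact/measurable_EFinP.
  - move=> w _; rewrite sumEFin -EFinD lee_fin.
    by apply: addr_ge0; [exact: ltW|exact: b0].
  - by rewrite lee_fin divr_ge0 ?invr_ge0// ltW.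
have Ifin : I \is a fin_num by exact: integrable_fin_num.
have := @expR_Rintegral_le _ _ _ M (fun w => - nce_integrand (k := n.+1) f x w).
rewrite iE; under eq_integral do rewrite EFinN.
rewrite integralN; last exact: integrable_add_def.
rewrite -/I -(fineK Ifin) /= lee_fin => /(_ (integrableN inc)).
have d0 : 0 < n.+1%:R^-1 * (a + c *+ n).
  by rewrite mulr_gt0 ?invr_gt0// ltr_pwDl// mulrn_wge0.
rewrite -ler_ln ?posrE ?expR_gt0 ?divr_gt0// expRK lerNl lee_fin.
rewrite -lnV ?posrE ?divr_gt0//.
by rewrite invf_div.
Qed.

(** The integrand decreases in the sum over the negatives, which is at least [n c] on the
    full-measure rectangle with all sides [S]. *)
Lemma integral_nce_cond_le d1 d2 (U : measurableType d1) (V : measurableType d2)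
    (R : realType) n (M : probability (n.-tuple V) R)
    (f : U * V -> R) (x : U * V) (c : R) (S : set V) :
  0 <= c -> measurable S -> M (rect (fun=> S)) = 1%E ->
  (forall v, S v -> c <= expR (f (x.1, v))) ->
  M.-integrable setT (fun w => (nce_integrand (k := n.+1) f x w)%:E) ->
  (\int[M]_w (nce_integrand (k := n.+1) f x w)%:E <=
   (ln (expR (f x) / (n.+1%:R^-1 * (expR (f x) + c *+ n))))%:E)%E.
Proof.
move=> c0 mS MS Sc inc; set m := ln _.
have <- : (\int[M]_w (cst m%:E w) = m%:E)%E.
  by rewrite integral_cst//= probability_setT mule1.
apply: ae_le_integral => //; first exact: measurable_int inc.
have mrS : measurable (rect (fun _ : 'I_n => S)) by exact: measurable_rect.
exists (~` rect (fun=> S)); split; first exact: measurableC.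
  transitivity (1 - M (rect (fun=> S)))%E; first exact: probability_setC.
  by rewrite MS subee.
move=> w; apply: contra_not => Sw /=; rewrite lee_fin /nce_integrand /m.
have a0 := expR_gt0 (f x).
have cn : c *+ n <= \sum_(j < n) expR (f (x.1, tnth w j)).
  rewrite -[n in c *+ n]card_ord -sumr_const; apply: ler_sum => j _.
  exact/Sc/Sw.
have cn0 : 0 <= c *+ n by rewrite mulrn_wge0.
have n0 : (0 : R) < n.+1%:R^-1 by rewrite invr_gt0.
rewrite ler_ln ?posrE ?divr_gt0 ?mulr_gt0 ?ltr_pwDl// ?(le_trans cn0)//.
rewrite ler_pM2l// lef_pV2 ?posrE ?mulr_gt0 ?ltr_pwDl// ?(le_trans cn0)//.
by rewrite ler_pM2l// lerD2l.
Qed.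

(** * The upper bound by mutual information *)

Lemma mutual_information_ge d1 d2 (U : measurableType d1) (V : measurableType d2)
    (R : realType) (P : probability (U * V)%type R) (h : U * V -> R) :
  P.-integrable setT (EFin \o h) ->
  (\int[marginal_product P]_x (expR (h x))%:E <= 1)%E ->
  (\int[P]_x (h x)%:E <= mutual_information P)%E.
Proof.
rewrite /mutual_information => ih h1; case: pselect => PQ; last exact: leey.
exact: donsker_varadhan.
Qed.

Lemma NCE_le_mutual_information d1 d2 (U : measurableType d1)
    (V : measurableType d2) (R : realType) n (P : probability (U * V)%type R)
    (M : probability (n.-tuple V) R) (f : U * V -> R) :
  iid (marginal2 P) M -> measurable_fun setT f ->
  (forall x, M.-integrable setT (fun w => (nce_integrand (k := n.+1) f x w)%:E)) ->
  P.-integrable setT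
    (fun x => \int[M]_w (nce_integrand (k := n.+1) f x w)%:E)%E ->
  (\int[P]_x \int[M]_w (nce_integrand (k := n.+1) f x w)%:E <=
   mutual_information P)%E.
Proof.
move=> Mp mf inc iP.
pose h x := fine (\int[M]_w (nce_integrand (k := n.+1) f x w)%:E)%E.
have hE x : (\int[M]_w (nce_integrand (k := n.+1) f x w)%:E)%E = (h x)%:E.
  by rewrite fineK//; exact: integrable_fin_num.
under eq_integral do rewrite hE.
have ih : P.-integrable setT (EFin \o h).
  by apply: eq_integrable iP => // x _; rewrite hE.
apply: mutual_information_ge => //.
pose Z (y : U * V * n.-tuple V) :=
  n.+1%:R^-1 * (expR (f y.1) + \sum_(j < n) expR (f (y.1.1, tnth y.2 j))).
have Z0 y : 0 < Z y.
  by rewrite mulr_gt0 ?invr_gt0// ltr_pwDl ?expR_gt0// sumr_ge0.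
pose G (y : U * V * n.-tuple V) := (expR (f y.1) / Z y)%:E.
have GE x w : (expR (nce_integrand (k := n.+1) f x w))%:E = G (x, w).
  rewrite /nce_integrand lnK// posrE divr_gt0 ?expR_gt0//.
  exact: (Z0 (x, w)).
have G0 y : (0 <= G y)%E by rewrite lee_fin divr_ge0 ?expR_ge0// ltW.
have mG : measurable_fun setT G.
  apply/measurable_EFinP.
  rewrite (_ : (fun _ => _) = fun y => expR (f y.1 - ln (Z y))); last first.
    by apply/funext => y; rewrite expRD expRN lnK// posrE.
  have mf1 : measurable_fun setT (fun y : U * V * n.-tuple V => f y.1).
    exact: measurableT_comp.
  apply: measurableT_comp => //; apply: measurable_funB => //.
  apply: measurableT_comp => //; apply: measurable_funM => //.
  apply: measurable_funD; first exact: measurableT_comp.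
  apply: measurable_sum => j; do 2 apply: measurableT_comp => //.
  apply: measurable_fun_pair.
    exact: (measurableT_comp measurable_fst measurable_fst).
  exact: (measurableT_comp (measurable_tnth j) measurable_snd).
(* Jensen over the negatives, separately for each [x]. *)
apply: (@le_trans _ _ (\int[marginal_product P]_x \int[M]_w G (x, w))%E).
  apply: ge0_le_integral => //.
  - apply/measurable_EFinP; apply: measurableT_comp => //.
    by apply/measurable_EFinP; exact: measurable_int ih.
  - exact: (measurable_fun_fubini_tonelli_F (m2 := M)).
  - move=> x _; under eq_integral do rewrite -GE.
    exact: expR_Rintegral_le (inc x).
(* Integrating over [v] first, with [u] fixed, makes [v] one more i.i.d. sample, so that [iid_share]
   applies to [f (u, _)]. *)
rewrite fubini_tonelli1; last 2 first.
- exact: (measurable_fun_fubini_tonelli_F (m2 := M)).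
- by move=> x; exact: integral_ge0.
have share u : (\int[marginal2 P]_v \int[M]_w G (u, v, w) = 1)%E.
  apply: (iid_share (F := fun v => f (u, v)) Mp).
  by apply: measurableT_comp => //; exact: pair1_measurable.
rewrite /fubini_F; under eq_integral do rewrite share.
by rewrite integral_cst//= probability_setT mule1.
Qed.

Unset Implicit Arguments.

Theorem theorem1 (d1 d2 : measure_display)
  (U : measurableType d1) (V : measurableType d2) (R : realType)
  (P : probability (U * V)%type R) (k : nat) (f : U * V -> R)
  (B : U -> set R)
  (q : U -> probability ((k.-1).-tuple V) R)
  (piid : probability ((k.-1).-tuple V) R) :
  (1 < k)%N ->
  measurable_fun [set: U * V] f ->
  (* c(u) = E_{v ~ p(v)} e^{f(u,v)} is finite *)
  (forall u, (\int[marginal2 P]_v (expR (f (u, v)))%:E < +oo)%E) ->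
  (* B_u is a Borel set strictly lower-bounded by c(u) *)
  (forall u, measurable (B u)) ->
  (forall u b, B u b -> (\int[marginal2 P]_v (expR (f (u, v)))%:E < b%:E)%E) ->
  (* p(S_{B_u}) > 0 *)
  (forall u, (0 < marginal2 P [set v | B u (expR (f (u, v)))])%E) ->
  (* q(. | u) : V_2, ..., V_k i.i.d. from p(v) conditioned on S_{B_u} *)
  (forall u (A : 'I_(k.-1) -> set V), (forall j, measurable (A j)) ->
     q u (rect A) =
     (\prod_(j < k.-1)
        condp (marginal2 P) [set v | B u (expR (f (u, v)))] (A j))%:E) ->
  (* piid : V_2, ..., V_k i.i.d. from p(v) *)
  (forall A : 'I_(k.-1) -> set V, (forall j, measurable (A j)) ->
     piid (rect A) = (\prod_(j < k.-1) fine (marginal2 P (A j)))%:E) ->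
  (* all expectations are well defined *)
  (forall x : U * V,
     (q x.1).-integrable [set: (k.-1).-tuple V]
       (fun w => (nce_integrand f x w)%:E)) ->
  (forall x : U * V,
     piid.-integrable [set: (k.-1).-tuple V]
       (fun w => (nce_integrand f x w)%:E)) ->
  P.-integrable [set: U * V]
    (fun x => \int[q x.1]_w (nce_integrand f x w)%:E)%E ->
  P.-integrable [set: U * V]
    (fun x => \int[piid]_w (nce_integrand f x w)%:E)%E ->
  let L_CNCE := (\int[P]_x \int[q x.1]_w (nce_integrand f x w)%:E)%E in
  let L_NCE := (\int[P]_x \int[piid]_w (nce_integrand f x w)%:E)%E in
  (L_CNCE <= L_NCE)%E /\ (L_NCE <= mutual_information P)%E.
Proof.
(* Now [k = n.+2], so there are [n.+1] negatives and the lemmas are used with [n.+1] for their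
   [n]. *)
case: k q piid => [|[|n]]// q piid _ mf cfin mB cB pS qE piidE inq inp iPq iPp LC LN.
have Mp : iid (marginal2 P) piid := piidE.
split; last exact: NCE_le_mutual_information.
apply: le_integral => // x _.
pose c := fine (\int[marginal2 P]_v (expR (f (x.1, v)))%:E)%E.
pose S := [set v | B x.1 (expR (f (x.1, v)))].
have I0 : (0 <= \int[marginal2 P]_v (expR (f (x.1, v)))%:E)%E.
  by apply: integral_ge0 => v _; rewrite lee_fin expR_ge0.
have cE : (\int[marginal2 P]_v (expR (f (x.1, v)))%:E = c%:E)%E.
  by rewrite fineK// ge0_fin_numE.
have mS : measurable S.
  rewrite -[X in measurable X]setTI; apply: (_ : measurable_fun setT _) => //.
  by do 2 apply: measurableT_comp => //; exact: pair1_measurable.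
apply: (@le_trans _ _
  (ln (expR (f x) / (n.+2%:R^-1 * (expR (f x) + c *+ n.+1))))%:E).
  apply: (integral_nce_cond_le (S := S)) => //.
  - exact: fine_ge0.
  (* Each factor is [p(S) / p(S)], equal to 1 because [p(S)] is positive and finite. *)
  - rewrite qE; last by [].
    rewrite big1// => j _; rewrite /condp setIid divff//.
    by rewrite gt_eqF// fine_gt0// pS ltey_eq fin_num_measure.
  - by move=> v /cB; rewrite cE lte_fin => /ltW.
exact: (integral_nce_iid_ge Mp mf cE).
Qed.
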